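(* Let $\mathbb K$ be a field and let $d\geq 1$ be an integer. Suppose there exist scalars $\{\theta_{i}\}_{i=0}^{d}$, $\{\theta^{*}_{i}\}_{i=0}^{d}$, $\{a_{i}\}_{i=0}^{d}$, $\{b_{i}\}_{i=0}^{d-1}$, $\{c_{i}\}_{i=1}^{d}$ in $\mathbb K$ such that the following (i)--(viii) hold. (i) $\theta_{i}\neq\theta_{j}$ if $i\neq j$ $(0\leq i,j\leq d)$. (ii) $\theta^{*}_{i}\neq\theta^{*}_{0}$ $(1\leq i\leq d)$. (iii) There exist $\beta,\gamma^{*}\in\mathbb K$ such that $\gamma^{*}=\theta^{*}_{i-1}-\beta\theta^{*}_{i}+\theta^{*}_{i+1}$ for $1\leq i\leq d-1$. Define $\theta^{*}_{-1}$ (resp. $\theta^{*}_{d+1}$) such that this equation also holds at $i=0$ (resp. $i=d$). (iv) $b_{i-1}c_{i}\neq 0$ for $1\leq i\leq d$. (v) $c_{i}+a_{i}+b_{i}=\theta_{0}$ for $0\leq i\leq d$, where $b_{d}=c_{0}=0$. (vi) There exists $a^{*}_{0}\in\mathbb K$ such that $$c_{i}(\theta^{*}_{i-1}-\theta^{*}_{i})-b_{i}(\theta^{*}_{i}-\theta^{*}_{i+1})=(\theta_{1}-\theta_{0})(\theta^{*}_{i}-a^{*}_{0})\qquad(0\leq i\leq d).$$ (vii) There exists $\theta_{-1}\in\mathbb K$ such that the expression $$c_{i}(\theta^{*}_{i-1}-\theta^{*}_{i+1})-b_{i-1}(\theta^{*}_{i-2}-\theta^{*}_{i})-(\theta_{0}-\theta_{-1})(\theta^{*}_{i-1}+\theta^{*}_{i})$$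 is independent of $i$ for $1\leq i\leq d$. (viii) With $\gamma$ defined by $\gamma=\theta_{-1}-\beta\theta_{0}+\theta_{1}$ (where $\beta$ is from (iii) and $\theta_{-1}$ is from (vii)), one has $\theta_{i-1}-\beta\theta_{i}+\theta_{i+1}=\gamma$ for $1\leq i\leq d-1$. Then there exists a Leonard system over $\mathbb K$ with eigenvalue sequence $\{\theta_{i}\}_{i=0}^{d}$, dual eigenvalue sequence $\{\theta^{*}_{i}\}_{i=0}^{d}$, and intersection numbers $\{a_{i}\}_{i=0}^{d}$, $\{b_{i}\}_{i=0}^{d-1}$, $\{c_{i}\}_{i=1}^{d}$.
   Context: Let $V$ be a vector space over $\mathbb K$ of dimension $d+1$ and $\mathrm{End}(V)$ the algebra of $\mathbb K$-linear maps $V\to V$. The symbol $A^{*}$ is just a name for a linear map (not an adjoint or conjugate-transpose). An element of $\mathrm{End}(V)$ is multiplicity-free if it is diagonalizable (over $\mathbb K$) and each of its eigenspaces has dimension one. For a multiplicity-free $A$, the primitive idempotent of $A$ for an eigenvalue $\theta$ is the projection onto the $\theta$-eigenspace that vanishes on all other eigenspaces. A Leonard system on $V$ (said to be over $\mathbb K$) is a sequence $\Phi=(A;\{E_{i}\}_{i=0}^{d};A^{*};\{E^{*}_{i}\}_{i=0}^{d})$ such that: each of $A,A^{*}$ is a multiplicity-free element of $\mathrm{End}(V)$; $\{E_{i}\}_{i=0}^{d}$ is an ordering of the primitive idempotents of $A$; $\{E^{*}_{i}\}_{i=0}^{d}$ is an ordering of the primitive idempotents of $A^{*}$; for $0\le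 i,j\le d$, each of $E^{*}_{i}AE^{*}_{j}$ and $E_{i}A^{*}E_{j}$ is zero if $|i-j|>1$ and nonzero if $|i-j|=1$. The eigenvalue sequence (resp. dual eigenvalue sequence) of $\Phi$ is $\{\theta_{i}\}_{i=0}^{d}$ (resp. $\{\theta^{*}_{i}\}_{i=0}^{d}$), where $\theta_{i}$ (resp. $\theta^{*}_{i}$) is the eigenvalue of $A$ (resp. $A^{*}$) on $E_{i}V$ (resp. $E^{*}_{i}V$). Intersection numbers of $\Phi$: choose $0\neq u\in E_{0}V$. It is known that $\{E^{*}_{i}u\}_{i=0}^{d}$ is a basis of $V$. With respect to this basis $A$ is represented by an irreducible tridiagonal matrix (tridiagonal with all subdiagonal and superdiagonal entries nonzero), whose $(i,i)$-entry is denoted $a_{i}$ $(0\le i\le d)$, $(i,i+1)$-entry is denoted $b_{i}$ $(0\le i\le d-1)$, and $(i,i-1)$-entry is denoted $c_{i}$ $(1\le i\le d)$ (rows and columns indexed by $0,\dots,d$; a matrix $Y$ represents $X$ with respect to a basis $\{v_i\}$ when $Xv_{j}=\sum_{i}Y_{ij}v_{i}$). These scalars do not depend on the choice of $u$; $\{a_{i}\}_{i=0}^{d}$, $\{b_{i}\}_{i=0}^{d-1}$, $\{c_{i}\}_{i=1}^{d}$ are the intersection numbers of $\Phi$. *)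

(* Defs.v *)
From HB Require Import structures.
From mathcomp Require Export all_boot all_order all_algebra.

Set Implicit Arguments.
Unset Strict Implicit.
Unset Printing Implicit Defensive.

Export Order.TTheory GRing.Theory Num.Theory.

Local Open Scope ring_scope.

Definition diagonalizable_end (K : fieldType) (V : vectType K)
    (A : 'End(V)) : Prop :=
  exists X : seq V, basis_of {:V} X
    /\ forall v, v \in X -> exists t : K, A v = t *: v.

Definition multiplicity_free (K : fieldType) (V : vectType K)
    (A : 'End(V)) : Prop :=
  diagonalizable_end A
    /\ forall t : K, passmx.leigenvalue A t -> \dim (passmx.leigenspace A t) = 1%N.

Definition primitive_idempotent (K : fieldType) (V : vectType K)
    (A : 'End(V)) (t : K) (E : 'End(V)) : Prop :=
  [/\ passmx.leigenvalue A t,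
      (E \o E)%VF = E,
      limg E = passmx.leigenspace A t
    & forall (s : K) (v : V), s != t -> v \in passmx.leigenspace A s -> E v = 0].

Definition idempotent_ordering (K : fieldType) (V : vectType K) (d : nat)
    (A : 'End(V)) (E : 'I_d.+1 -> 'End(V)) : Prop :=
  injective E
    /\ forall F : 'End(V),
         (exists t : K, primitive_idempotent A t F) <-> (exists i, E i = F).

Definition tridiagonal_action (K : fieldType) (V : vectType K) (d : nat)
    (A : 'End(V)) (F : 'I_d.+1 -> 'End(V)) : Prop :=
  forall i j : 'I_d.+1,
    ((`|i - j| > 1)%N -> (F i \o A \o F j)%VF = 0)
    /\ (`|i - j|%N = 1%N -> (F i \o A \o F j)%VF <> 0).

Record leonard_system (K : fieldType) (d : nat) (V : vectType K) : Type :=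
  LeonardSystem {
    ls_A : 'End(V);
    ls_E : 'I_d.+1 -> 'End(V);
    ls_As : 'End(V);
    ls_Es : 'I_d.+1 -> 'End(V);
    ls_dim : \dim {:V} = d.+1;
    ls_mf : multiplicity_free ls_A;
    ls_mfs : multiplicity_free ls_As;
    ls_ord : idempotent_ordering ls_A ls_E;
    ls_ords : idempotent_ordering ls_As ls_Es;
    ls_trid : tridiagonal_action ls_A ls_Es;
    ls_trids : tridiagonal_action ls_As ls_E
  }.

(* Sequences of scalars are functions on [int], so that the indices -1 and
   d + 1 are available; only the values in the stated ranges are used. *)

Definition eigenvalue_sequence (K : fieldType) (d : nat) (V : vectType K)
    (Phi : leonard_system d V) (theta : int -> K) : Prop :=
  forall (i : 'I_d.+1) (v : V),
    v \in limg (ls_E Phi i) -> ls_A Phi v = theta i *: v.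

Definition dual_eigenvalue_sequence (K : fieldType) (d : nat)
    (V : vectType K) (Phi : leonard_system d V) (thetas : int -> K) : Prop :=
  forall (i : 'I_d.+1) (v : V),
    v \in limg (ls_Es Phi i) -> ls_As Phi v = thetas i *: v.

Definition represents (K : fieldType) (V : vectType K) (n : nat)
    (v : 'I_n -> V) (X : 'End(V)) (Y : 'M[K]_n) : Prop :=
  forall j : 'I_n, X (v j) = \sum_(i < n) Y i j *: v i.

Definition irreducible_tridiagonal (K : fieldType) (n : nat)
    (Y : 'M[K]_n) : Prop :=
  forall i j : 'I_n,
    ((`|i - j| > 1)%N -> Y i j = 0) /\ (`|i - j|%N = 1%N -> Y i j != 0).

Definition intersection_numbers (K : fieldType) (d : nat) (V : vectType K)
    (Phi : leonard_system d V) (a b c : int -> K) : Prop :=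
  forall u : V, u \in limg (ls_E Phi ord0) -> u != 0 ->
    basis_of {:V} [seq ls_Es Phi i u | i : 'I_d.+1]
    /\ exists Y : 'M[K]_d.+1,
         [/\ represents (fun i => ls_Es Phi i u) (ls_A Phi) Y,
             irreducible_tridiagonal Y,
             forall i : 'I_d.+1, Y i i = a i,
             forall i j : 'I_d.+1, j = i.+1 :> nat -> Y i j = b i
           & forall i j : 'I_d.+1, i = j.+1 :> nat -> Y i j = c i].

(* Main.v *)
(* Realize A as the tridiagonal matrix with entries c_i, a_i, b_i and A* as the
   diagonal matrix with entries theta*_i. By (v) and (vi), the all-ones vector u
   and (A* - a*_0) u are eigenvectors of A for theta_0 and theta_1. The heart of
   the proof is the Askey-Wilson relation
     A^2 A* - beta A A* A + A* A^2 - gamma (A A* + A* A) - rho A*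
       = gamma* A^2 + omega A + eta.
   Its off-diagonal entries amount to (iii) and to a consequence of (vi) and
   (vii); hence the difference of both sides is diagonal, and it vanishes because
   it kills u. The relation forces A* to send a theta_i-eigenvector of A into the
   sum of the eigenspaces for theta_{i-1}, theta_i, theta_{i+1}, so eigenvectors
   w_0 = u, w_1, ..., w_d can be built one after the other. None of them is zero:
   otherwise the previous ones span a proper subspace invariant under A and A*
   that contains u, hence contains the first basis vector by (ii), hence is
   everything. Finally A and A* are both self-adjoint for a diagonal bilinear
   form, so the matrix of A* in the basis (w_i), known to be irreducible
   tridiagonal below the diagonal, is so above the diagonal too. *)

From HB Require Import structures.
Require Import Defs.
From mathcomp Require Import ring zify.

Set Implicit Arguments.
Unset Strict Implicit.
Unset Printing Implicit Defensive.

Local Open Scope ring_scope.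

(** * Bases and the projections onto their lines *)

Section BasisProjection.
Variables (K : fieldType) (V : vectType K) (n : nat) (X : n.-tuple V).
Hypothesis basisX : basis_of {:V} X.

Definition coord_line (i : 'I_n) (v : V) : V := coord X i v *: X`_i.

Lemma coord_line_linear i : linear (coord_line i).
Proof. by move=> k u v; rewrite /coord_line linearP scalerDl scalerA. Qed.

HB.instance Definition _ i :=
  GRing.isLinear.Build K V V *:%R (coord_line i) (@coord_line_linear i).

Definition basis_proj (i : 'I_n) : 'End(V) := linfun (coord_line i).

Lemma basis_projE i v : basis_proj i v = coord X i v *: X`_i.
Proof. by rewrite lfunE. Qed.

Lemma coord_expand v : v = \sum_(i < n) coord X i v *: X`_i.
Proof. exact: (coord_basis basisX (memvf v)). Qed.

Lemma coordX (i j : 'I_n) : coord X i X`_j = (i == j)%:R.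
Proof. by rewrite coord_free 1?eq_sym ?(basis_free basisX). Qed.

Lemma basis_neq0 (i : 'I_n) : X`_i != 0.
Proof.
by apply: (basis_not0 basisX); rewrite mem_nth ?size_tuple.
Qed.

Lemma basis_proj_basis (i j : 'I_n) :
  basis_proj i X`_j = (i == j)%:R *: X`_j.
Proof.
by rewrite basis_projE coordX; case: eqP => [->|_] //; rewrite !scale0r.
Qed.

Lemma eq_on_basis (f g : 'End(V)) :
  (forall i : 'I_n, f X`_i = g X`_i) -> f = g.
Proof.
move=> fg; apply/lfunP => v; rewrite (coord_expand v) !linear_sum.
by apply: eq_bigr => i _; rewrite !linearZ /= fg.
Qed.

Lemma basis_proj_inj : injective basis_proj.
Proof.
move=> i j eqE; apply/eqP; case: eqP => // /eqP neq_ij.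
have := congr1 (fun f : 'End(V) => f X`_i) eqE.
rewrite /= !basis_proj_basis eqxx eq_sym (negbTE neq_ij) scale1r scale0r.
by move=> X0; have := basis_neq0 i; rewrite X0 eqxx.
Qed.

Lemma limg_basis_proj i : limg (basis_proj i) = <[X`_i]>%VS.
Proof.
apply/eqP; rewrite eqEsubv; apply/andP; split.
  apply/subvP => _ /memv_imgP [v _ ->].
  by rewrite basis_projE memvZ ?memv_line.
rewrite -memvE; apply/memv_imgP; exists X`_i; rewrite ?memvf //.
by rewrite basis_proj_basis eqxx scale1r.
Qed.

(** The composite kills every basis vector except the j-th, which it sends to the (i, j)-entry of
    [B] times the i-th. The conditions on E_i B E_j thus become conditions on single matrix
    entries. *)
Lemma basis_proj_sandwich (B : 'End(V)) (i j : 'I_n) :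
  (basis_proj i \o B \o basis_proj j)%VF = 0 <-> coord X i (B X`_j) = 0.
Proof.
split=> [E0|c0].
  have := congr1 (fun f : 'End(V) => f X`_j) E0.
  rewrite /= !comp_lfunE basis_proj_basis eqxx scale1r zero_lfunE.
  rewrite basis_projE => /eqP; rewrite scaler_eq0 (negbTE (basis_neq0 i)) orbF.
  by move/eqP.
apply/lfunP => v; rewrite !comp_lfunE zero_lfunE (basis_projE j) !linearZ /=.
by rewrite basis_projE c0 scale0r scaler0.
Qed.

Variables (A : 'End(V)) (t : 'I_n -> K).
Hypothesis t_inj : injective t.
Hypothesis eigenX : forall i : 'I_n, A X`_i = t i *: X`_i.

Lemma coord_eigenbasis i v : coord X i (A v) = t i * coord X i v.
Proof.
rewrite {1}(coord_expand v) !linear_sum (bigD1 i) //= big1 => [|j neq_ji].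
  by rewrite addr0 !linearZ /= eigenX linearZ /= coordX eqxx mulr1 mulrC.
by rewrite !linearZ /= eigenX linearZ /= coordX eq_sym (negbTE neq_ji) !mulr0.
Qed.

Lemma mem_eigenspace s v :
  (v \in passmx.leigenspace A s) = (A v == s *: v).
Proof. by rewrite memv_ker add_lfunE opp_lfunE scale_lfunE id_lfunE subr_eq0. Qed.

(** Comparing j-th coordinates in A v = t_i v gives (t_i - t_j) v_j = 0, so only the i-th coordinate
    survives. *)
Lemma eigenspace_basis i : passmx.leigenspace A (t i) = <[X`_i]>%VS.
Proof.
apply/vspaceP => v; rewrite mem_eigenspace; apply/eqP/vlineP => [Av|[k ->]].
  exists (coord X i v); rewrite {1}(coord_expand v) (bigD1 i) //= big1 ?addr0 //.
  move=> j neq_ji; have := coord_eigenbasis j v; rewrite Av linearZ /= => /eqP.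
  rewrite -subr_eq0 -mulrBl mulf_eq0 subr_eq0 (inj_eq t_inj) eq_sym.
  by rewrite (negbTE neq_ji) => /eqP ->; rewrite scale0r.
by rewrite linearZ /= eigenX scalerA mulrC -scalerA.
Qed.

(** Any nonzero coordinate of an eigenvector reveals its eigenvalue. *)
Lemma eigenvalue_basis s : passmx.leigenvalue A s -> exists i, s = t i.
Proof.
rewrite /passmx.leigenvalue -vpick0 => v_neq0.
have := memv_pick (passmx.leigenspace A s); rewrite mem_eigenspace.
set v := vpick _ in v_neq0 * => /eqP Av.
have [i ci|c0] := pickP (fun i => coord X i v != 0).
  exists i; have := coord_eigenbasis i v; rewrite Av linearZ /=.
  exact: mulIf.
case/eqP: v_neq0; rewrite (coord_expand v) big1 // => i _.
by move/eqP: (c0 i) => ->; rewrite scale0r.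
Qed.

Lemma eigenvalue_basis_proj i : passmx.leigenvalue A (t i).
Proof.
by rewrite /passmx.leigenvalue eigenspace_basis -dimv_eq0 dim_vline basis_neq0.
Qed.

Lemma eigenbasis_multiplicity_free : multiplicity_free A.
Proof.
split=> [|s /eigenvalue_basis [i ->]]; last first.
  by rewrite eigenspace_basis dim_vline basis_neq0.
exists X; split=> // v /(nthP 0) [i]; rewrite size_tuple => lt_in <-.
by exists (t (Ordinal lt_in)); rewrite -(eigenX (Ordinal lt_in)).
Qed.

Lemma primitive_idempotent_basis_proj i :
  primitive_idempotent A (t i) (basis_proj i).
Proof.
split; first exact: eigenvalue_basis_proj.
- apply: eq_on_basis => j; rewrite comp_lfunE basis_proj_basis linearZ /=.
  by rewrite basis_proj_basis; case: eqP; rewrite ?scale1r ?scale0r.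
- by rewrite limg_basis_proj eigenspace_basis.
move=> s v neq_s vs.
have [v0|v_neq0] := eqVneq v 0; first by rewrite v0 linear0.
have /eigenvalue_basis [j def_s] : passmx.leigenvalue A s.
  apply: contra v_neq0 => /eqP V0; rewrite V0 in vs.
  by rewrite -memv0.
move: vs neq_s; rewrite def_s (inj_eq t_inj) eigenspace_basis.
case/vlineP=> k -> neq_ji; rewrite linearZ /= basis_proj_basis eq_sym.
by rewrite (negbTE neq_ji) scale0r scaler0.
Qed.

(** The two maps agree on the basis: [F] kills the other eigenspaces and, being idempotent, fixes
    its image. *)
Lemma primitive_idempotent_uniq i (F : 'End(V)) :
  primitive_idempotent A (t i) F -> basis_proj i = F.
Proof.
case=> _ FF imF kerF; apply: eq_on_basis => j; rewrite basis_proj_basis.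
case: eqP => [<-|/eqP neq_ij]; last first.
  rewrite scale0r (kerF (t j)) ?(inj_eq t_inj) 1?eq_sym //.
  by rewrite eigenspace_basis memv_line.
rewrite scale1r; have : X`_i \in limg F.
  by rewrite imF eigenspace_basis memv_line.
by case/memv_imgP=> v _ ->; rewrite -[in LHS]FF comp_lfunE.
Qed.

End BasisProjection.

Lemma eigenbasis_idempotent_ordering (K : fieldType) (V : vectType K) (d : nat)
    (X : d.+1.-tuple V) (A : 'End(V)) (t : 'I_d.+1 -> K) :
  basis_of {:V} X -> injective t ->
  (forall i : 'I_d.+1, A X`_i = t i *: X`_i) ->
  idempotent_ordering A (basis_proj X).
Proof.
move=> basisX t_inj eigenX; split; first exact: basis_proj_inj.
move=> F; split=> [[s primF]|[i <-]]; last first.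
  by exists (t i); apply: primitive_idempotent_basis_proj.
have [s_eig _ _ _] := primF.
have [i def_s] := eigenvalue_basis basisX eigenX s_eig.
exists i; rewrite def_s in primF.
exact: (primitive_idempotent_uniq basisX t_inj eigenX primF).
Qed.

Lemma basis_proj_tridiagonal (K : fieldType) (V : vectType K) (d : nat)
    (X : d.+1.-tuple V) (B : 'End(V)) :
  basis_of {:V} X ->
  (forall i j : 'I_d.+1, (`|i - j| > 1)%N -> coord X i (B X`_j) = 0) ->
  (forall i j : 'I_d.+1, `|i - j|%N = 1%N -> coord X i (B X`_j) != 0) ->
  tridiagonal_action B (basis_proj X).
Proof.
move=> basisX far near i j; split=> [/far c0|/near].
  exact/basis_proj_sandwich.
by move=> /eqP c_neq0; rewrite basis_proj_sandwich.
Qed.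

(** * The Askey-Wilson relation on sequences of scalars *)

Section TridiagonalData.
Variables (K : fieldType) (d : nat) (theta thetas a b c : int -> K).
Variables (beta gamma gammas : K).
Hypothesis bd0 : b d = 0.
Hypothesis c00 : c 0 = 0.

Definition tridiag_op (f : int -> K) (i : int) : K :=
  c i * f (i - 1) + a i * f i + b i * f (i + 1).

Local Notation T := tridiag_op.

(** The out-of-range values [f (-1)] and [f (d + 1)] are multiplied by [c 0] and [b d], which
    vanish. This permits rewriting inside nested uses of [T]. *)
Lemma eq_tridiag_op (f g : int -> K) :
  (forall i : int, 0 <= i <= d -> f i = g i) ->
  forall i : int, 0 <= i <= d -> T f i = T g i.
Proof.
move=> fg i i_d; rewrite /T (fg i i_d); congr (_ + _ + _).
  by have [->|i_neq0] := eqVneq i 0; rewrite ?c00 ?mul0r // fg //; lia.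
by have [->|i_neqd] := eqVneq i d; rewrite ?bd0 ?mul0r // fg //; lia.
Qed.

(* The value at f of the left-hand side minus the terms gamma* A^2 + omega A of the
   Askey-Wilson relation, for A = T and A* = multiplication by thetas. *)
Definition AW_op (om rho : K) (f : int -> K) (i : int) : K :=
  T (T (fun k => thetas k * f k)) i - beta * T (fun k => thetas k * T f k) i
  + thetas i * T (T f) i
  - gamma * (T (fun k => thetas k * f k) i + thetas i * T f i)
  - gammas * T (T f) i - om * T f i - rho * (thetas i * f i).

(* Up to (iii), the (i, i-1) and (i-1, i) entries of the relation say that this
   quantity equals omega. *)
Definition AW_offdiag (i : int) : K :=
  a i * (thetas i - thetas (i + 1)) + a (i - 1) * (thetas (i - 1) - thetas (i - 2))
  - gamma * (thetas i + thetas (i - 1)).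

Hypothesis rec_thetas : forall i : int, 0 <= i <= d ->
  gammas = thetas (i - 1) - beta * thetas i + thetas (i + 1).

(** Entries two off the diagonal are multiples of the defect [H] of (iii), those next to the
    diagonal are multiples of [O]. Only the diagonal remains, and the constant sequence 1 reads it
    off. *)
Lemma AW_op_diag (om rho : K) :
  (forall i : int, 1 <= i <= d -> AW_offdiag i = om) ->
  forall (f : int -> K) (i : int), 0 <= i <= d ->
    AW_op om rho f i = f i * AW_op om rho (fun=> 1) i.
Proof.
move=> offdiag f i i_d.
pose H (j : int) := thetas (j - 1) - beta * thetas j + thetas (j + 1) - gammas.
have H0 (j : int) : 0 <= j <= d -> H j = 0 by rewrite /H => /rec_thetas ->; rewrite subrr.
(* [c j * O j] and [b (j - 1) * O j] are the (j, j-1) and (j-1, j) entries of [AW_op om rho]. *)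
pose O (j : int) := (a j + a (j - 1)) * (thetas (j - 1) + thetas j)
  - beta * (a j * thetas j + a (j - 1) * thetas (j - 1))
  - gamma * (thetas j + thetas (j - 1)) - gammas * (a j + a (j - 1)) - om.
have O0 (j : int) : 1 <= j <= d -> O j = 0.
  move=> j_d; rewrite /O -(offdiag j j_d) /AW_offdiag.
  have Hj := H0 j ltac:(lia); have Hj1 := H0 (j - 1) ltac:(lia).
  transitivity (a j * H j + a (j - 1) * H (j - 1)).
    by rewrite /H subrK (_ : j - 2 = j - 1 - 1); [ring | lia].
  by rewrite Hj Hj1 !mulr0 addr0.
(* At i = 0 or i = d the argument of [O] or [H] may leave the range where these vanish, but then the
   factor [c i] or [b i] is zero. *)
have c1 : c i * O i = 0.
  by have [->|i_neq0] := eqVneq i 0; [rewrite c00 mul0r | rewrite O0 ?mulr0 //; lia].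
have b1 : b i * O (i + 1) = 0.
  by have [->|i_neqd] := eqVneq i d; [rewrite bd0 mul0r | rewrite O0 ?mulr0 //; lia].
have c2 : c i * H (i - 1) = 0.
  by have [->|i_neq0] := eqVneq i 0; [rewrite c00 mul0r | rewrite H0 ?mulr0 //; lia].
have b2 : b i * H (i + 1) = 0.
  by have [->|i_neqd] := eqVneq i d; [rewrite bd0 mul0r | rewrite H0 ?mulr0 //; lia].
apply/eqP; rewrite -subr_eq0; apply/eqP.
transitivity (c i * H (i - 1) * (c (i - 1) * (f (i - 1 - 1) - f i))
  + b i * H (i + 1) * (b (i + 1) * (f (i + 1 + 1) - f i))
  + c i * O i * (f (i - 1) - f i) + b i * O (i + 1) * (f (i + 1) - f i)).
  rewrite /AW_op /T /H /O !subrK !addrK; ring.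
by rewrite c1 b1 c2 b2 !mul0r !addr0.
Qed.

Variables (as0 theta_m1 : K).
Hypothesis row_sum : forall i : int, 0 <= i <= d -> c i + a i + b i = theta 0.
Hypothesis first_eigenvector : forall i : int, 0 <= i <= d ->
    c i * (thetas (i - 1) - thetas i) - b i * (thetas i - thetas (i + 1))
    = (theta 1 - theta 0) * (thetas i - as0).
Hypothesis bc_relation : forall i j : int, 1 <= i <= d -> 1 <= j <= d ->
    c i * (thetas (i - 1) - thetas (i + 1))
      - b (i - 1) * (thetas (i - 2) - thetas i)
      - (theta 0 - theta_m1) * (thetas (i - 1) + thetas i)
    = c j * (thetas (j - 1) - thetas (j + 1))
      - b (j - 1) * (thetas (j - 2) - thetas j)
      - (theta 0 - theta_m1) * (thetas (j - 1) + thetas j).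
Hypothesis def_gamma : gamma = theta_m1 - beta * theta 0 + theta 1.

(** With the a's eliminated by (v), adding (vi) at j and j - 1 and subtracting theta_0 times (iii)
    at j and j - 1 turns [AW_offdiag j] into minus the expression of (vii) plus a constant. *)
Lemma AW_offdiag_const (i : int) :
  1 <= i <= d -> AW_offdiag i = AW_offdiag 1.
Proof.
have offdiagE (j : int) : 1 <= j <= d -> AW_offdiag j =
    - (c j * (thetas (j - 1) - thetas (j + 1))
      - b (j - 1) * (thetas (j - 2) - thetas j)
      - (theta 0 - theta_m1) * (thetas (j - 1) + thetas j))
    - 2 * (theta 0 * gammas + (theta 1 - theta 0) * as0).
  move=> j_d; rewrite /AW_offdiag.
  have aj : a j = theta 0 - c j - b j by rewrite -(row_sum (i := j)); [ring | lia].
  have aj1 : a (j - 1) = theta 0 - c (j - 1) - b (j - 1).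
    by rewrite -(row_sum (i := j - 1)); [ring | lia].
  have := first_eigenvector (i := j) ltac:(lia).
  have := first_eigenvector (i := j - 1) ltac:(lia).
  have := rec_thetas (i := j) ltac:(lia).
  have := rec_thetas (i := j - 1) ltac:(lia).
  rewrite subrK (_ : j - 1 - 1 = j - 2); last lia; move=> g1 g0 e1 e0.
  apply/eqP; rewrite -subr_eq0 aj aj1 def_gamma; apply/eqP.
  pose G0 := thetas (j - 1) - beta * thetas j + thetas (j + 1) - gammas.
  pose G1 := thetas (j - 2) - beta * thetas (j - 1) + thetas j - gammas.
  pose F0 := c j * (thetas (j - 1) - thetas j) - b j * (thetas j - thetas (j + 1))
    - (theta 1 - theta 0) * (thetas j - as0).
  pose F1 := c (j - 1) * (thetas (j - 2) - thetas (j - 1))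
    - b (j - 1) * (thetas (j - 1) - thetas j)
    - (theta 1 - theta 0) * (thetas (j - 1) - as0).
  transitivity (F0 + F1 - theta 0 * (G0 + G1)).
    by rewrite /F0 /F1 /G0 /G1; ring.
  have -> : F0 = 0 by rewrite /F0 e0 subrr.
  have -> : F1 = 0 by rewrite /F1 e1 subrr.
  have -> : G0 = 0 by rewrite /G0 -g0 subrr.
  have -> : G1 = 0 by rewrite /G1 -g1 subrr.
  by rewrite !addr0 mulr0 subr0.
move=> i_d; rewrite (offdiagE i) // (offdiagE 1); last lia.
by rewrite (bc_relation (i := i) (j := 1)) //; lia.
Qed.

(* Chosen so that the component of [AW_op _ AW_rho (fun=> 1)] along the
   theta_1-eigenvector vanishes. *)
Definition AW_rho : K :=
  theta 0 ^+ 2 - beta * theta 0 * theta 1 + theta 1 ^+ 2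
  - gamma * (theta 0 + theta 1).

(** This is [AW_op] with theta_0 put for A and a*_0 for A*: its component along u when applied to u,
    since A* u is a*_0 u plus a theta_1-eigenvector. *)
Definition AW_eta : K :=
  as0 * theta 0 ^+ 2 * (2 - beta) - 2 * gamma * as0 * theta 0
  - gammas * theta 0 ^+ 2 - AW_offdiag 1 * theta 0 - AW_rho * as0.

Lemma tridiag_op1 (i : int) : 0 <= i <= d -> T (fun=> 1) i = theta 0.
Proof. by move=> i_d; rewrite /T !mulr1 row_sum. Qed.

(** By (v) and (vi) the span of 1 and theta* is stable under [T]; [AW_op1] is computed inside it. *)
Lemma tridiag_op_thetas (x y : K) (i : int) : 0 <= i <= d ->
  T (fun k => x * thetas k + y) i
  = x * (theta 1 * thetas i - (theta 1 - theta 0) * as0) + y * theta 0.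
Proof.
move=> i_d; have := first_eigenvector i_d; have := row_sum i_d.
rewrite /T => r e.
transitivity (x * (c i * (thetas (i - 1) - thetas i)
     - b i * (thetas i - thetas (i + 1))) + (x * thetas i + y) * (c i + a i + b i)).
  by ring.
by rewrite e r; ring.
Qed.

Lemma AW_op1 (i : int) : 0 <= i <= d ->
  AW_op (AW_offdiag 1) AW_rho (fun=> 1) i = AW_eta.
Proof.
move=> i_d; rewrite /AW_op.
have TE : forall f x y, (forall k : int, 0 <= k <= d -> f k = x * thetas k + y) ->
    forall k : int, 0 <= k <= d -> T f k
    = (x * theta 1) * thetas k + (y * theta 0 - x * ((theta 1 - theta 0) * as0)).
  move=> f x y fE k k_d; rewrite (eq_tridiag_op fE k_d) tridiag_op_thetas //.
  ring.
have T1 := tridiag_op1.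
have T11 : forall k : int, 0 <= k <= d -> T (T (fun=> 1)) k = theta 0 ^+ 2.
  move=> k k_d; rewrite (TE _ 0 (theta 0)) // => [|l l_d]; first by ring.
  by rewrite T1 //; ring.
have TD : forall k : int, 0 <= k <= d -> T (fun k => thetas k * 1) k
    = theta 1 * thetas k - (theta 1 - theta 0) * as0.
  by move=> k k_d; rewrite (TE _ 1 0) // => [|l l_d]; ring.
rewrite T1 // T11 // TD //.
rewrite (TE (fun k => thetas k * _) (theta 0) 0) //; last first.
  by move=> k k_d; rewrite T1 //; ring.
rewrite (TE (T _) (theta 1) (- (theta 1 - theta 0) * as0)) //; last first.
  by move=> k k_d; rewrite TD //; ring.
by rewrite /AW_eta /AW_rho; ring.
Qed.

Lemma AW_relation_pointwise (f : int -> K) (i : int) : 0 <= i <= d ->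
  AW_op (AW_offdiag 1) AW_rho f i = AW_eta * f i.
Proof.
by move=> i_d; rewrite (AW_op_diag _ AW_offdiag_const) // AW_op1 // mulrC.
Qed.

End TridiagonalData.

(** * The maps A and A* on column vectors *)

Section LeonardConstruction.
Variables (K : fieldType) (d : nat) (theta thetas a b c : int -> K).
Hypothesis d_gt0 : (1 <= d)%N.
Hypothesis theta_neq : forall i j : int, 0 <= i <= d -> 0 <= j <= d -> i != j ->
    theta i != theta j.
Hypothesis thetas_neq0 : forall i : int, 1 <= i <= d -> thetas i != thetas 0.
Variables (beta gamma gammas as0 theta_m1 : K).
Hypothesis rec_thetas : forall i : int, 0 <= i <= d ->
  gammas = thetas (i - 1) - beta * thetas i + thetas (i + 1).
Hypothesis bc_neq0 : forall i : int, 1 <= i <= d -> b (i - 1) * c i != 0.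
Hypothesis bd0 : b d = 0.
Hypothesis c00 : c 0 = 0.
Hypothesis row_sum : forall i : int, 0 <= i <= d -> c i + a i + b i = theta 0.
Hypothesis first_eigenvector : forall i : int, 0 <= i <= d ->
    c i * (thetas (i - 1) - thetas i) - b i * (thetas i - thetas (i + 1))
    = (theta 1 - theta 0) * (thetas i - as0).
Hypothesis bc_relation : forall i j : int, 1 <= i <= d -> 1 <= j <= d ->
    c i * (thetas (i - 1) - thetas (i + 1))
      - b (i - 1) * (thetas (i - 2) - thetas i)
      - (theta 0 - theta_m1) * (thetas (i - 1) + thetas i)
    = c j * (thetas (j - 1) - thetas (j + 1))
      - b (j - 1) * (thetas (j - 2) - thetas j)
      - (theta 0 - theta_m1) * (thetas (j - 1) + thetas j).
Hypothesis def_gamma : gamma = theta_m1 - beta * theta 0 + theta 1.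
Hypothesis rec_theta : forall i : int, 1 <= i <= d%:Z - 1 ->
    theta (i - 1) - beta * theta i + theta (i + 1) = gamma.

Local Notation V := 'cV[K]_d.+1.

Let b_neq0 (i : int) : 0 <= i < d -> b i != 0.
Proof.
move=> i_d; have := bc_neq0 (i := i + 1) ltac:(lia).
by rewrite addrK mulf_eq0 => /norP [].
Qed.

Let c_neq0 (i : int) : 1 <= i <= d -> c i != 0.
Proof. by move=> /bc_neq0; rewrite mulf_eq0 => /norP []. Qed.

(* Coordinates of a column vector, extended by 0 to all integer indices. *)
Definition ext (x : V) (k : int) : K :=
  \sum_(j < d.+1) (j%:Z == k)%:R * x j 0.

Lemma ext_ord (x : V) (i : 'I_d.+1) : ext x i = x i 0.
Proof.
rewrite /ext (bigD1 i) //= eqxx mul1r big1 ?addr0 // => j neq_ji.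
by rewrite eqz_nat -val_eqE in neq_ji *; rewrite (negbTE neq_ji) mul0r.
Qed.

Lemma extD x y k : ext (x + y) k = ext x k + ext y k.
Proof. by rewrite -big_split; apply: eq_bigr => j _; rewrite mxE mulrDr. Qed.

Lemma extZ t x k : ext (t *: x) k = t * ext x k.
Proof. by rewrite mulr_sumr; apply: eq_bigr => j _; rewrite mxE mulrCA. Qed.

Lemma extN x k : ext (- x) k = - ext x k.
Proof. by rewrite -scaleN1r extZ mulN1r. Qed.

Lemma ext0 k : ext 0 k = 0.
Proof. by rewrite -(scale0r 0) extZ mul0r. Qed.

Definition extE := (extD, extZ, extN, ext0).

Lemma ext_inj (x y : V) : (forall k : int, 0 <= k <= d -> ext x k = ext y k) -> x = y.
Proof.
move=> eq_xy; apply/colP => i; rewrite -!ext_ord eq_xy //.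
by have := ltn_ord i; lia.
Qed.

(** Indexed by integers: an index out of range gives the zero vector, so [mapA_unit_vec] has no
    boundary cases. *)
Definition unit_vec (m : int) : V := \col_i (i%:Z == m)%:R.

Lemma ext_unit_vec (m k : int) : 0 <= k <= d -> ext (unit_vec m) k = (k == m)%:R.
Proof.
case: k => // k; rewrite le0z_nat /= => le_kd.
by rewrite (ext_ord _ (Ordinal (le_kd : (k < d.+1)%N))) mxE.
Qed.

Lemma unit_vec_expand (x : V) : x = \sum_(i < d.+1) ext x i *: unit_vec i.
Proof.
apply/colP => i; rewrite summxE (bigD1 i) //= big1 => [|j neq_ji].
  by rewrite !mxE eqxx mulr1 addr0 ext_ord.
by rewrite !mxE eqz_nat eq_sym (negbTE neq_ji : (j == i :> nat) = false) mulr0.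
Qed.

(** A sum of indicators matching those in [ext], so that [ext_mapA] can be checked term by term. *)
Definition tridiag_mx : 'M[K]_d.+1 := \matrix_(i, j)
  ((j%:Z == i%:Z - 1)%:R * c i + (j%:Z == i%:Z)%:R * a i + (j%:Z == i%:Z + 1)%:R * b i).

Definition mapA : 'End(V) := linfun (mulmx tridiag_mx).
Definition mapAs : 'End(V) := linfun (mulmx (diag_mx (\row_(i < d.+1) thetas i))).

Local Notation A := mapA.
Local Notation As := mapAs.
Local Notation T := (tridiag_op a b c).

Lemma ext_mapA x (k : int) : 0 <= k <= d -> ext (A x) k = T (ext x) k.
Proof.
case: k => // k; rewrite le0z_nat /= => le_kd.
rewrite (ext_ord _ (Ordinal (le_kd : (k < d.+1)%N))) lfunE mxE /tridiag_op /ext !mulr_sumr.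
rewrite -!big_split; apply: eq_bigr => j _; rewrite mxE /=; ring.
Qed.

Lemma ext_mapAs x (k : int) : 0 <= k <= d -> ext (As x) k = thetas k * ext x k.
Proof.
case: k => // k; rewrite le0z_nat /= => le_kd.
by rewrite !(ext_ord _ (Ordinal (le_kd : (k < d.+1)%N))) lfunE /= mul_diag_mx !mxE.
Qed.

Lemma mapA_unit_vec (m : int) : 0 <= m <= d ->
  A (unit_vec m)
  = b (m - 1) *: unit_vec (m - 1) + a m *: unit_vec m + c (m + 1) *: unit_vec (m + 1).
Proof.
move=> m_d; apply: ext_inj => k k_d; rewrite ext_mapA // !extE /tridiag_op.
have -> : c k * ext (unit_vec m) (k - 1) = c k * (k - 1 == m)%:R.
  have [->|k_neq0] := eqVneq k 0; first by rewrite c00 !mul0r.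
  by rewrite ext_unit_vec //; lia.
have -> : b k * ext (unit_vec m) (k + 1) = b k * (k + 1 == m)%:R.
  have [->|k_neqd] := eqVneq k d; first by rewrite bd0 !mul0r.
  by rewrite ext_unit_vec //; lia.
rewrite !ext_unit_vec // (_ : (k - 1 == m) = (k == m + 1)); last first.
  by rewrite subr_eq.
rewrite addrC [X in _ + X]addrC addrA; congr (_ + _ + _).
- case: eqP => [<-|k_m]; first by rewrite addrK eqxx.
  by case: eqP => [k_m'|_]; [lia | rewrite !mulr0].
- by case: eqP => [->|_]; rewrite ?mulr0.
by case: eqP => [->|_]; rewrite ?mulr0.
Qed.

(** * The Askey-Wilson relation for the maps, and the eigenspaces of A *)

Local Notation omega := (AW_offdiag thetas a gamma 1).
Local Notation rho := (AW_rho theta beta gamma).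
Local Notation eta := (AW_eta theta thetas a beta gamma gammas as0).

Lemma AW_relation (x : V) :
  A (A (As x)) - beta *: A (As (A x)) + As (A (A x))
  - gamma *: (A (As x) + As (A x)) - gammas *: A (A x) - omega *: A x - rho *: As x
  = eta *: x.
Proof.
apply: ext_inj => k k_d; rewrite !extE.
rewrite -(AW_relation_pointwise bd0 c00 rec_thetas row_sum first_eigenvector
  bc_relation def_gamma (ext x) k_d) /AW_op.
have TA := eq_tridiag_op a bd0 c00.
have eAs : forall k : int, 0 <= k <= d -> T (ext (As x)) k
    = T (fun k => thetas k * ext x k) k.
  by apply: TA => l; apply: ext_mapAs.
have eAsA : forall k : int, 0 <= k <= d -> T (ext (As (A x))) k
    = T (fun k => thetas k * T (ext x) k) k.
  by apply: TA => l l_d; rewrite ext_mapAs // ext_mapA.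
have eAA : forall k : int, 0 <= k <= d -> T (ext (A x)) k = T (T (ext x)) k.
  by apply: TA => l l_d; rewrite ext_mapA.
rewrite !(ext_mapA, ext_mapAs) // eAsA // eAA // eAs // (TA (ext (A (As x)))
  (T (fun k => thetas k * ext x k))) // => l l_d.
by rewrite ext_mapA // eAs.
Qed.

(** The right-hand side is a first integral of (viii): its increment from n to n + 1 is theta_{n+2}
    - theta_n times theta_n - beta theta_{n+1} + theta_{n+2} - gamma, which is zero. *)
Lemma AW_rhoE (n : nat) : (n < d)%N ->
  rho = theta n ^+ 2 - beta * theta n * theta (n%:Z + 1) + theta (n%:Z + 1) ^+ 2
    - gamma * (theta n + theta (n%:Z + 1)).
Proof.
elim: n => [|n IHn] n_d; first by rewrite /AW_rho add0r.
rewrite (IHn (ltnW n_d)) -(rec_theta (i := n%:Z + 1)); last lia.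
by rewrite addrK (_ : n.+1%:Z = n%:Z + 1) ?intS 1?addrC //; ring.
Qed.

(** As [b n] is nonzero, row n of A x = t x determines coordinate n + 1 from coordinates n - 1 and
    n. *)
Lemma mapA_eigen_eq0 (t : K) (x : V) : A x = t *: x -> ext x 0 = 0 -> x = 0.
Proof.
move=> Ax x0.
suff x_eq0 (n : nat) : (n <= d)%N -> ext x n = 0.
  by apply: ext_inj => -[k|//] k_d; rewrite ext0 x_eq0 //; lia.
elim/ltn_ind: n => -[//|n] IHn n_d.
have := congr1 (ext^~ n) Ax; rewrite /= ext_mapA ?extZ; last lia.
have xn : ext x n = 0 by apply: IHn; lia.
rewrite /tridiag_op xn !mulr0 addr0.
have -> : c n * ext x (n%:Z - 1) = 0.
  case: (n) IHn n_d => [|m] IHn n_d; first by rewrite c00 mul0r.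
  by rewrite (_ : m.+1%:Z - 1 = m) ?IHn ?mulr0 //; lia.
rewrite add0r (_ : n%:Z + 1 = n.+1) ; last lia.
move/eqP; rewrite mulf_eq0 (negbTE (b_neq0 _)) => [|]; last lia.
by move/eqP.
Qed.

Lemma mapA_eigen_line (t : K) (x y : V) :
  A x = t *: x -> A y = t *: y -> x != 0 -> exists k, y = k *: x.
Proof.
move=> Ax Ay x_neq0.
have x0 : ext x 0 != 0.
  by apply: contra_neq x_neq0; apply: mapA_eigen_eq0 Ax.
exists (ext y 0 / ext x 0); apply/eqP; rewrite -subr_eq0; apply/eqP.
apply: (@mapA_eigen_eq0 t); last by rewrite !extE divfK // subrr.
by rewrite linearB linearZ /= Ax Ay scalerBr !scalerA mulrC.
Qed.

(** * The chain of eigenvectors of A *)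

Definition ones : V := const_mx 1.

Lemma ext_ones (k : int) : 0 <= k <= d -> ext ones k = 1.
Proof.
case: k => // k; rewrite le0z_nat /= => le_kd.
by rewrite (ext_ord _ (Ordinal (le_kd : (k < d.+1)%N))) mxE.
Qed.

(** A* w_{m+1} has components only for theta_m, theta_{m+1}, theta_{m+2}; applying A - theta_m and A
    - theta_{m+1} leaves a multiple of the last one. *)
Fixpoint eigvec (n : nat) : V :=
  if n is n'.+1 then
    if n' is m.+1 then
      let y := As (eigvec n') in
      let z := A y - theta m *: y in A z - theta n' *: z
    else As ones - as0 *: ones
  else ones.

Local Notation w := eigvec.

Lemma eigvecSS n (y := As (w n.+1)) : w n.+2 =
  A (A y) - (theta n + theta n.+1) *: A y + (theta n * theta n.+1) *: y.
Proof.
rewrite /= -/y linearB linearZ /= scalerBr scalerDl scalerA [theta n.+1 * _]mulrC.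
by rewrite !opprD opprK !addrA.
Qed.

(* For the eigenvalue theta_{n+1}, the relation becomes quadratic in A acting on
   A* x, and the recurrence (viii) makes theta_n and theta_{n+2} its roots. *)
Lemma AW_eigen_factor n (x : V) (y := As x) : (n.+1 < d)%N ->
  A x = theta n.+1 *: x -> exists k,
  A (A y) - (theta n + theta n.+2) *: A y + (theta n * theta n.+2) *: y = k *: x.
Proof.
move=> n_d Ax.
(* The terms of the relation that are multiples of [x] once A x = theta_{n+1} x is substituted. *)
exists (eta + gammas * theta n.+1 ^+ 2 + omega * theta n.+1).
have n1E : n.+1%:Z = n%:Z + 1 by lia.
have := rec_theta (i := n.+1) ltac:(lia).
rewrite {1}n1E addrK (_ : n.+1%:Z + 1 = n.+2); last lia.
(* Writing rho through theta_n and theta_{n+1} makes the constant coefficient of the quadratic equal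
   to theta_n theta_{n+2}. *)
move=> def_t; have := AW_rhoE (ltnW n_d); rewrite -n1E => def_rho.
have := AW_relation x; rewrite Ax !linearZ /= Ax !linearZ /= -/y => AWx.
apply: ext_inj => k k_d; have := congr1 (ext^~ k) AWx.
rewrite /= !extE def_rho -def_t => AWk.
apply/eqP; rewrite -subr_eq0; move/eqP: AWk; rewrite -subr_eq0.
by congr (_ == _); ring.
Qed.

(** For indices from 2 on, the factors A - theta commute: (A - theta_{n+2}) w_{n+2} is A -
    theta_{n+1} applied to the vector of [AW_eigen_factor], a multiple of w_{n+1}, hence zero. The
    first two cases are (v) and (vi). *)
Lemma eigvec_eigen n : (n <= d)%N -> A (w n) = theta n *: w n.
Proof.
elim: n => [|[|n] IHn] n_d.
- apply: ext_inj => k k_d; rewrite ext_mapA // extZ ext_ones // mulr1.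
  by rewrite (eq_tridiag_op a bd0 c00 ext_ones) // /tridiag_op !mulr1 row_sum.
- apply: ext_inj => k k_d; rewrite ext_mapA //.
  have w1 (l : int) : 0 <= l <= d -> ext (w 1) l = 1 * thetas l - as0.
    by move=> l_d; rewrite !extE ext_mapAs // ext_ones //; ring.
  rewrite (eq_tridiag_op a bd0 c00 w1) // (tridiag_op_thetas row_sum first_eigenvector) //.
  by rewrite extZ w1 //; ring.
have [k Ek] := AW_eigen_factor n_d (IHn (ltnW n_d)).
have Aw := IHn (ltnW n_d).
move: Ek; rewrite eigvecSS; set y := As _ => Ek.
have Aquad (p q : K) : A (A (A y) - p *: A y + q *: y)
    = A (A (A y)) - p *: A (A y) + q *: A y by rewrite !(linearD, linearN, linearZ).
have := congr1 A Ek; rewrite Aquad [A (_ *: _)]linearZ /= Aw => AEk.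
apply/eqP; rewrite -subr_eq0; apply/eqP.
transitivity (k *: (theta n.+1 *: w n.+1) - theta n.+1 *: (k *: w n.+1)); last first.
  by rewrite !scalerA mulrC subrr.
rewrite -Ek -AEk Aquad.
apply: ext_inj => l l_d; rewrite !extE; ring.
Qed.

(** The components of A* w_n are peeled off one eigenvalue at a time; nonzero w_n and w_{n-1} span
    their eigenspaces by [mapA_eigen_line]. *)
Lemma mapAs_eigvec n : (n < d)%N -> w n != 0 -> w n.-1 != 0 ->
  exists kappa mu nu, kappa != 0 /\
    As (w n) = kappa *: w n.+1 + mu *: w n + nu *: w n.-1.
Proof.
case: n => [|n] n_d wn wp.
  (* At n = 0 the index [n.-1] is again 0, and its coefficient is 0. *)
  by exists 1, as0, 0; rewrite oner_neq0 scale1r scale0r addr0 /= subrK.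
rewrite [n.+1.-1]/=; set p := theta n; set q := theta n.+1; set r := theta n.+2.
have theta_neq' (i j : nat) : (i <= d)%N -> (j <= d)%N -> i != j -> theta i - theta j != 0.
  by move=> i_d j_d ij; rewrite subr_eq0 theta_neq //; lia.
have rq : r - q != 0 by apply: theta_neq'; lia.
have rp : r - p != 0 by apply: theta_neq'; lia.
have qp : q - p != 0 by apply: theta_neq'; lia.
have Aw2 := eigvec_eigen n_d; have Aw1 := eigvec_eigen (ltnW n_d).
have Aw0 := eigvec_eigen (ltnW (ltnW n_d)).
have wE := eigvecSS n; rewrite -/p -/q -/r in wE Aw2 Aw1 Aw0.
move: (w n.+2) (w n.+1) (w n) wE Aw2 Aw1 Aw0 wn wp => w2 w1 w0.
set y := As w1 => wE Aw2 Aw1 Aw0 w1_neq0 w0_neq0.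
have Asub (z x : V) (s : K) : A (z - s *: x) = A z - s *: A x.
  by rewrite linearB linearZ.
have rqrp : (r - q) * (r - p) != 0 by rewrite mulf_neq0.
(* (A - p)(A - q) sends y to w2 and w2 to (r - p)(r - q) w2, so it kills y - kappa w2. *)
pose kappa := ((r - q) * (r - p))^-1.
pose y1 := y - kappa *: w2.
have [mu Emu] : exists mu, A y1 - p *: y1 = mu *: w1.
  apply: mapA_eigen_line Aw1 _ w1_neq0.
  apply/eqP; rewrite -subr_eq0; apply/eqP.
  rewrite Asub /y1 !Asub Aw2 [A (r *: _)]linearZ /= Aw2.
  transitivity (w2 - (kappa * ((r - q) * (r - p))) *: w2).
    rewrite wE; apply: ext_inj => l l_d; rewrite !extE; ring.
  by rewrite mulVf // scale1r subrr.
(* A - p multiplies w1 by q - p, so this correction leaves a vector killed by A - p. *)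
pose y2 := y1 - (mu / (q - p)) *: w1.
have [nu Enu] : exists nu, y2 = nu *: w0.
  apply: mapA_eigen_line Aw0 _ w0_neq0; apply/eqP; rewrite -subr_eq0; apply/eqP.
  rewrite /y2 Asub Aw1.
  transitivity (A y1 - p *: y1 - (mu / (q - p) * (q - p)) *: w1).
    by apply: ext_inj => l l_d; rewrite !extE; ring.
  by rewrite divfK // Emu subrr.
exists kappa, (mu / (q - p)), nu; split; first by rewrite invr_eq0.
by rewrite -Enu /y2 /y1; apply: ext_inj => l l_d; rewrite !extE; ring.
Qed.

(** * Nonvanishing and independence of the eigenvectors *)

Arguments eigvec : simpl never.

Lemma invariant_full (W : {vspace V}) :
  {in W, forall x, A x \in W} -> {in W, forall x, As x \in W} -> ones \in W ->
  forall x, x \in W.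
Proof.
move=> WA WAs W1.
(* Applying A* - theta*_k for k = 1, ..., m to u kills coordinates 1 to m, while by (ii) coordinate
   0 stays nonzero. *)
have lead (m : nat) : (m <= d)%N -> exists2 x, x \in W &
    ext x 0 != 0 /\ forall k : int, 1 <= k <= m -> ext x k = 0.
  elim: m => [|m IHm] m_d.
    by exists ones => //; split=> [|k]; [rewrite ext_ones ?oner_neq0 | lia].
  have [x Wx [x0 xm]] := IHm (ltnW m_d).
  exists (As x - thetas m.+1 *: x); first by rewrite memvB ?memvZ ?WAs.
  split=> [|k k_m]; rewrite !extE ext_mapAs; try lia; rewrite -mulNr -mulrDl.
    by rewrite mulf_neq0 // subr_eq0 eq_sym thetas_neq0 //; lia.
  have [->|neq_km] := eqVneq k m.+1; first by rewrite subrr mul0r.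
  by rewrite xm ?mulr0 //; lia.
have W0 : unit_vec 0 \in W.
  have [x Wx [x0 xd]] := lead d (leqnn d).
  suff -> : unit_vec 0 = (ext x 0)^-1 *: x by rewrite memvZ.
  apply: ext_inj => k k_d; rewrite ext_unit_vec // extZ.
  have [->|k_neq0] := eqVneq k 0; first by rewrite mulVf.
  by rewrite (xd k) ?mulr0 //; lia.
(* Since [c (m + 1)] is nonzero, A climbs from one unit vector to the next. *)
have Wu (m : nat) : (m <= d)%N -> unit_vec m \in W.
  elim/ltn_ind: m => -[|m] // IHm m_d.
  have Wm := IHm m (ltnSn m) (ltnW m_d).
  have Wp : b (m%:Z - 1) *: unit_vec (m%:Z - 1) \in W.
    case: (m) IHm m_d => [|l] IHm m_d; last first.
      by rewrite (_ : l.+1%:Z - 1 = l) ?memvZ ?IHm //; lia.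
    suff -> : unit_vec (0 - 1) = 0 by rewrite scaler0 mem0v.
    by apply: ext_inj => k k_d; rewrite ext_unit_vec // ext0; case: eqP => // k_m; lia.
  have m1E : m%:Z + 1 = m.+1 by lia.
  have := mapA_unit_vec (m := m) ltac:(lia); rewrite m1E => Am.
  suff -> : unit_vec m.+1 = (c m.+1)^-1 *:
      (A (unit_vec m) - b (m%:Z - 1) *: unit_vec (m%:Z - 1) - a m *: unit_vec m).
    by rewrite memvZ // memvB ?(memvZ _ Wm) // memvB ?WA.
  rewrite Am -[_ - _ - _]addrA -opprD [X in _ *: X]addrAC subrr add0r scalerA mulVf ?scale1r //.
  by apply: c_neq0; lia.
move=> x; rewrite (unit_vec_expand x) memv_suml // => i _.
by rewrite memvZ ?Wu //; have := ltn_ord i; lia.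
Qed.

Lemma dim_column_space : \dim {:V} = d.+1.
Proof. by rewrite dimvf /dim /= muln1. Qed.

Lemma mapAs_eigvec_span n (U : {vspace V}) : (n < d)%N ->
  (forall m : nat, (m <= n)%N -> w m != 0) ->
  (forall m : nat, (m <= n.+1)%N -> w m \in U) -> As (w n) \in U.
Proof.
move=> n_d w_neq0 Uw; have [||ka [mu [nu [_ ->]]]] := mapAs_eigvec n_d.
- exact: w_neq0.
- by apply: w_neq0; lia.
by rewrite !memvD ?memvZ ?Uw //; lia.
Qed.

Lemma eigvec_neq0 n : (n <= d)%N -> w n != 0.
Proof.
elim/ltn_ind: n => n IHn n_d; apply/eqP => wn0.
pose W := <<mkseq w n>>%VS.
have Ww m : (m <= n)%N -> w m \in W.
  rewrite leq_eqVlt => /orP [/eqP -> | m_n]; first by rewrite wn0 mem0v.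
  by rewrite memv_span // map_f // mem_iota.
have WE (f : 'End(V)) : (forall m, (m < n)%N -> f (w m) \in W) ->
    {in W, forall x, f x \in W}.
  move=> Wf x Wx; suff: (f @: W <= W)%VS by move/subvP; apply; apply: memv_img.
  rewrite limg_span; apply/span_subvP => _ /mapP [_ /mapP [m m_n ->] ->].
  rewrite mem_iota in m_n.
  exact: Wf.
have n_gt0 : (0 < n)%N.
  rewrite lt0n; apply/eqP => n0; move: wn0; rewrite n0 => /(congr1 (ext^~ 0)).
  by move/eqP; rewrite /= ext_ones // ext0 oner_eq0.
have full : ({:V} <= W)%VS.
  apply/subvP => x _; apply: invariant_full x; last exact: (Ww 0%N).
    by apply: WE => m m_n; rewrite eigvec_eigen ?memvZ ?Ww; lia.
  (* For m = n - 1 the image involves w_n, which lies in [W] because it is zero. *)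
  apply: WE => m m_n; apply: mapAs_eigvec_span; first lia.
    by move=> l l_m; apply: IHn; lia.
  by move=> l l_m; apply: Ww; lia.
by have := leq_trans (dimvS full) (dim_span _); rewrite size_mkseq dim_column_space; lia.
Qed.

(** Applying A - theta_n removes the last term and scales the others by nonzero factors. *)
Lemma eigvec_free (k : nat -> K) n : (n <= d.+1)%N ->
  \sum_(i < n) k i *: w i = 0 -> forall i, (i < n)%N -> k i = 0.
Proof.
elim: n k => [//|n IHn] k n_d sum0.
have k0 i : (i < n)%N -> k i = 0.
  move=> i_n; have : k i * (theta i - theta n) = 0.
    apply: (IHn (fun i => k i * (theta i - theta n))) i_n; first lia.
    transitivity (A (\sum_(i < n.+1) k i *: w i)
                  - theta n *: \sum_(i < n.+1) k i *: w i); last first.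
      by rewrite sum0 linear0 scaler0 subrr.
    rewrite linear_sum scaler_sumr -sumrB big_ord_recr /=.
    rewrite linearZ /= eigvec_eigen // !scalerA mulrC subrr addr0.
    apply: eq_bigr => j _; rewrite linearZ /= eigvec_eigen; last first.
      by have := ltn_ord j; lia.
    by rewrite !scalerA -scalerBl mulrBr [theta n * _]mulrC.
  move/eqP; rewrite mulf_eq0 subr_eq0 => /orP [/eqP //|].
  by rewrite (negbTE (theta_neq _ _ _)) //; lia.
move=> i; rewrite ltnS leq_eqVlt => /orP [/eqP ->|]; last exact: k0.
move: sum0; rewrite big_ord_recr big1 /= => [|j _]; last by rewrite k0 ?scale0r.
by move/eqP; rewrite add0r scaler_eq0 (negbTE (eigvec_neq0 _)) // orbF => /eqP.
Qed.

(** * The two eigenbases and the distinctness of the theta*_i *)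

Definition eigbasis : d.+1.-tuple V := [tuple w i | i < d.+1].
Definition dual_eigbasis : d.+1.-tuple V := [tuple unit_vec i%:Z | i < d.+1].

Lemma nth_eigbasis (i : 'I_d.+1) : eigbasis`_i = w i.
Proof. by rewrite -tnth_nth tnth_mktuple. Qed.

Lemma nth_dual_eigbasis (i : 'I_d.+1) : dual_eigbasis`_i = unit_vec i.
Proof. by rewrite -tnth_nth tnth_mktuple. Qed.

Lemma eigbasis_basis : basis_of {:V} eigbasis.
Proof.
rewrite basisEfree subvf dim_column_space size_tuple leqnn !andbT.
apply/freeP => k sum0 i.
have kE (j : 'I_d.+1) : k (inord j) = k j by rewrite inord_val.
rewrite -kE; apply: (@eigvec_free (fun j => k (inord j)) d.+1) => //.
by rewrite -[RHS]sum0; apply: eq_bigr => j _; rewrite nth_eigbasis kE.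
Qed.

(** The scalar is needed for intersection numbers, where u is an arbitrary nonzero multiple of the
    all-ones vector. *)
Lemma scaled_unit_vec_basis (s : K) : s != 0 ->
  basis_of {:V} [seq s *: unit_vec i%:Z | i : 'I_d.+1].
Proof.
move=> s_neq0; rewrite basisEdim dim_column_space size_map -cardE card_ord leqnn.
rewrite andbT; apply/subvP => x _; rewrite (unit_vec_expand x) memv_suml // => i _.
rewrite -[ext x i](divfK s_neq0) -scalerA memvZ // memv_span //.
by apply/mapP; exists i; rewrite ?mem_enum.
Qed.

Lemma dual_eigbasis_basis : basis_of {:V} dual_eigbasis.
Proof.
suff -> : val dual_eigbasis = [seq 1 *: unit_vec i%:Z | i : 'I_d.+1].
  exact: scaled_unit_vec_basis (oner_neq0 K).
by apply: eq_map => i; rewrite scale1r.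
Qed.

Lemma coord_dual_eigbasis (i : 'I_d.+1) x : coord dual_eigbasis i x = ext x i.
Proof.
rewrite {1}(unit_vec_expand x) linear_sum (bigD1 i) //= big1 => [|j neq_ji].
  by rewrite linearZ /= -nth_dual_eigbasis (coordX dual_eigbasis_basis) eqxx
    mulr1 addr0.
rewrite linearZ /= -nth_dual_eigbasis (coordX dual_eigbasis_basis).
by rewrite eq_sym (negbTE neq_ji) mulr0.
Qed.

(** Hypothesis (ii) separates only theta*_0 from the others, whereas a multiplicity-free A* needs
    all of them distinct. *)
Lemma thetas_neq (i j : 'I_d.+1) : i != j -> thetas i != thetas j.
Proof.
move=> neq_ij; apply/eqP => eq_t.
have i_d := ltn_ord i; have j_d := ltn_ord j.
have eqAs x : ext x i = ext x j -> ext (As x) i = ext (As x) j.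
  by move=> eq_x; rewrite !ext_mapAs ?eq_t ?eq_x //; lia.
(* Vectors with equal i-th and j-th coordinates would form an A*-invariant
   subspace, which then contains all the eigenvectors. *)
have eq_w n : (n <= d)%N -> ext (w n) i = ext (w n) j.
  elim/ltn_ind: n => -[|n] IHn n_d; first by rewrite !ext_ones //; lia.
  have [||ka [mu [nu [ka_neq0 Asw]]]] := mapAs_eigvec n_d.
  - by apply: eigvec_neq0; lia.
  - by apply: eigvec_neq0; lia.
  have : ext (As (w n)) i = ext (As (w n)) j by apply/eqAs/IHn; lia.
  (* The terms in w_n and w_{n-1} agree by induction, and the nonzero factor of w_{n+1} cancels. *)
  rewrite Asw !extD !extZ (IHn n) 1?(IHn n.-1); try lia.
  by move/addIr/addIr/mulfI; apply.
have eq_x x : ext x i = ext x j.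
  rewrite (coord_expand eigbasis_basis x).
  elim/big_ind: _ => [|y z ey ez|k _]; rewrite ?ext0 ?extD ?ey ?ez //.
  by rewrite !extZ nth_eigbasis eq_w //; have := ltn_ord k; lia.
have := eq_x (unit_vec i); rewrite !ext_unit_vec; try lia.
rewrite eqxx eqz_nat eq_sym (negbTE (neq_ij : (i != j :> nat))).
by move/eqP; rewrite oner_eq0.
Qed.

(* Symmetrizes the tridiagonal matrix: weight i * b i = weight i.+1 * c i.+1. *)
Fixpoint weight (n : nat) : K :=
  if n is n'.+1 then weight n' * b n' / c n else 1.

Lemma weight_neq0 n : (n <= d)%N -> weight n != 0.
Proof.
elim: n => [|n IHn] n_d /=; first exact: oner_neq0.
rewrite !mulf_neq0 ?invr_eq0 ?IHn ?(ltnW n_d) //; first by apply: b_neq0; lia.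
by apply: c_neq0; lia.
Qed.

(** * The bilinear form making A and A* self-adjoint *)

Definition form (x y : V) : K := \sum_(i < d.+1) weight i * (x i 0 * y i 0).

Lemma formC x y : form x y = form y x.
Proof. by apply: eq_bigr => i _; rewrite [x i 0 * _]mulrC. Qed.

Lemma formZr t x y : form x (t *: y) = t * form x y.
Proof. by rewrite mulr_sumr; apply: eq_bigr => i _; rewrite mxE; ring. Qed.

Lemma formDr x y z : form x (y + z) = form x y + form x z.
Proof. by rewrite -big_split; apply: eq_bigr => i _; rewrite mxE /=; ring. Qed.

Lemma form0r x : form x 0 = 0.
Proof. by rewrite -(scale0r 0) formZr mul0r. Qed.

Lemma form_mapAs x y : form (As x) y = form x (As y).
Proof.
by apply: eq_bigr => i _; rewrite !lfunE /= !mul_diag_mx !mxE; ring.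
Qed.

Lemma weight_tridiag_mx (i j : 'I_d.+1) :
  weight i * tridiag_mx i j = weight j * tridiag_mx j i.
Proof.
wlog le_ij : i j / (i <= j)%N.
  by move=> H; case: (leqP i j) => [/H|/ltnW/H].
have j_d := ltn_ord j; rewrite !mxE.
case: (ltngtP i j) le_ij => [lt_ij _|//|/val_inj -> //].
(* Beyond the neighbouring diagonal both entries vanish; for j = i + 1 the identity is the recursion
   of [weight]. *)
have [def_j|neq_j] := eqVneq (j : nat) i.+1; last first.
  do 6 (rewrite (_ : (_ == _ :> int) = false) ?mul0r; last by apply/eqP; lia).
  by rewrite !addr0 !mulr0.
rewrite (_ : (j%:Z == i%:Z - 1) = false); last by apply/eqP; lia.
rewrite (_ : (j%:Z == i%:Z) = false); last by apply/eqP; lia.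
rewrite (_ : (j%:Z == i%:Z + 1) = true); last by apply/eqP; lia.
rewrite (_ : (i%:Z == j%:Z - 1) = true); last by apply/eqP; lia.
rewrite (_ : (i%:Z == j%:Z) = false); last by apply/eqP; lia.
rewrite (_ : (i%:Z == j%:Z + 1) = false); last by apply/eqP; lia.
rewrite !mul0r !mul1r !add0r !addr0 def_j /= divfK //.
by apply: c_neq0; lia.
Qed.

Lemma form_mapA x y : form (A x) y = form x (A y).
Proof.
transitivity (\sum_(i < d.+1) \sum_(j < d.+1) weight i * tridiag_mx i j * (x j 0 * y i 0)).
  apply: eq_bigr => i _; rewrite lfunE mxE mulr_suml mulr_sumr.
  by apply: eq_bigr => j _; ring.
rewrite exchange_big /=; apply: eq_bigr => i _; rewrite lfunE mxE !mulr_sumr.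
by apply: eq_bigr => j _; rewrite weight_tridiag_mx; ring.
Qed.

Lemma form_eigvec_orthogonal (i j : 'I_d.+1) : i != j -> form (w i) (w j) = 0.
Proof.
move=> neq_ij; have i_d := ltn_ord i; have j_d := ltn_ord j.
have neq_ijZ : i%:Z != j by rewrite eqz_nat.
have := form_mapA (w i) (w j).
rewrite formC !eigvec_eigen ?formZr; try lia; rewrite formC => /eqP.
rewrite -subr_eq0 -mulrBl mulf_eq0 subr_eq0 (negbTE (theta_neq _ _ _)) //; try lia.
by move/eqP.
Qed.

Lemma coord_form_eigvec (i : 'I_d.+1) x :
  form (w i) x = coord eigbasis i x * form (w i) (w i).
Proof.
rewrite {1}(coord_expand eigbasis_basis x).
rewrite (big_morph _ (formDr _) (form0r _)) (bigD1 i) //= big1 => [|j neq_ji].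
  by rewrite formZr nth_eigbasis addr0.
by rewrite formZr nth_eigbasis form_eigvec_orthogonal 1?eq_sym ?mulr0.
Qed.

(** Over a general field isotropic vectors may exist. But an isotropic w_i would be orthogonal to
    the whole space by [coord_form_eigvec], and pairing it with the unit vectors would give w_i =
    0. *)
Lemma form_eigvec_neq0 (i : 'I_d.+1) : form (w i) (w i) != 0.
Proof.
apply/eqP => w0; have i_d := ltn_ord i.
have /eqP[] := eigvec_neq0 (n := i) ltac:(lia).
apply/colP => j; have := coord_form_eigvec i (unit_vec j); rewrite w0 mulr0 => /eqP.
rewrite /form (bigD1 j) //= big1 => [|k neq_kj]; last first.
  by rewrite mxE eqz_nat (negbTE (neq_kj : (k != j :> nat))) !mulr0.
rewrite !mxE eqxx mulr1 addr0 mulf_eq0 (negbTE (weight_neq0 _)) => [/eqP //|].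
by have := ltn_ord j; lia.
Qed.

(** Self-adjointness of A* makes opposite entries agree up to the nonzero factors [form (w i) (w i)]
    and [form (w j) (w j)]. *)
Lemma coord_mapAs_sym (i j : 'I_d.+1) :
  (coord eigbasis i (As (w j)) == 0) = (coord eigbasis j (As (w i)) == 0).
Proof.
have := form_mapAs (w i) (w j); rewrite formC.
rewrite (coord_form_eigvec j (As _)) (coord_form_eigvec i (As _)) => E.
have := congr1 (eq_op^~ 0) E; rewrite /= !mulf_eq0.
by rewrite !(negbTE (form_eigvec_neq0 _)) !orbF => ->.
Qed.

(** By [mapAs_eigvec], column j has a nonzero entry in row j + 1 and zeros further down. *)
Lemma coord_mapAs_upper (i j : 'I_d.+1) : (j < i)%N ->
  (coord eigbasis i (As (w j)) == 0) = (j.+1 < i)%N.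
Proof.
move=> lt_ji; have i_d := ltn_ord i.
have [|||ka [mu [nu [ka_neq0 ->]]]] := mapAs_eigvec (n := j); first lia.
- by apply: eigvec_neq0; lia.
- by apply: eigvec_neq0; lia.
have cw (k : nat) : (k <= d)%N -> coord eigbasis i (w k) = (k == i)%:R.
  rewrite -ltnS => k_d; rewrite -(nth_eigbasis (Ordinal k_d)).
  by rewrite (coordX eigbasis_basis) eq_sym.
rewrite !linearD !linearZ /= !cw; try lia.
rewrite (_ : (j == i :> nat) = false); last by apply/eqP; lia.
rewrite (_ : (j.-1 == i) = false); last by apply/eqP; lia.
rewrite !mulr0 !addr0 mulf_eq0 (negbTE ka_neq0) /=.
rewrite [RHS]ltn_neqAle lt_ji andbT.
by case: (j.+1 == i); [exact: oner_eq0 | exact: eqxx].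
Qed.

(** * Assembly of the Leonard system *)

Lemma theta_inj : injective (fun i : 'I_d.+1 => theta i).
Proof.
move=> i j eq_t; apply/eqP; apply: contraT => neq_ij.
have i_d := ltn_ord i; have j_d := ltn_ord j.
have neq_ijZ : i%:Z != j by rewrite eqz_nat.
have /eqP[] : theta i != theta j by apply: theta_neq => //; lia.
exact: eq_t.
Qed.

Lemma thetas_inj : injective (fun i : 'I_d.+1 => thetas i).
Proof.
move=> i j eq_t; apply/eqP; apply: contraT => /thetas_neq /eqP[].
exact: eq_t.
Qed.

Lemma eigbasis_eigen (i : 'I_d.+1) : A eigbasis`_i = theta i *: eigbasis`_i.
Proof. by rewrite nth_eigbasis eigvec_eigen // -ltnS ltn_ord. Qed.

Lemma dual_eigbasis_eigen (i : 'I_d.+1) :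
  As dual_eigbasis`_i = thetas i *: dual_eigbasis`_i.
Proof.
rewrite nth_dual_eigbasis; apply: ext_inj => k k_d.
rewrite ext_mapAs // extZ ext_unit_vec //.
by case: eqP => [->|_] //; rewrite !mulr0.
Qed.

Lemma coord_mapA (i j : 'I_d.+1) :
  coord dual_eigbasis i (A dual_eigbasis`_j) = tridiag_mx i j.
Proof.
rewrite coord_dual_eigbasis nth_dual_eigbasis ext_ord lfunE mxE (bigD1 j) //= big1.
  by rewrite [unit_vec _ _ _]mxE eqxx mulr1 addr0.
by move=> k neq_kj; rewrite [unit_vec _ _ _]mxE eqz_nat (negbTE (neq_kj : k != j :> nat)) mulr0.
Qed.

Lemma tridiag_mx_diag (i : 'I_d.+1) : tridiag_mx i i = a i.
Proof.
rewrite mxE eqxx (_ : (_ == _ - 1) = false); last by apply/eqP; lia.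
rewrite (_ : (_ == _ + 1) = false); last by apply/eqP; lia.
by rewrite !mul0r mul1r add0r addr0.
Qed.

Lemma tridiag_mx_super (i j : 'I_d.+1) : j = i.+1 :> nat -> tridiag_mx i j = b i.
Proof.
move=> def_j; rewrite mxE (_ : (_ == _ - 1) = false); last by apply/eqP; lia.
rewrite (_ : (_ == i%:Z) = false); last by apply/eqP; lia.
rewrite (_ : (_ == _ + 1) = true); last by apply/eqP; lia.
by rewrite !mul0r mul1r !add0r.
Qed.

Lemma tridiag_mx_sub (i j : 'I_d.+1) : i = j.+1 :> nat -> tridiag_mx i j = c i.
Proof.
move=> def_i; rewrite mxE (_ : (_ == _ - 1) = true); last by apply/eqP; lia.
rewrite (_ : (_ == i%:Z) = false); last by apply/eqP; lia.
rewrite (_ : (_ == _ + 1) = false); last by apply/eqP; lia.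
by rewrite !mul0r mul1r !addr0.
Qed.

Lemma tridiag_mx_irreducible : irreducible_tridiagonal tridiag_mx.
Proof.
move=> i j; have i_d := ltn_ord i; have j_d := ltn_ord j; split=> ij.
  rewrite mxE; do 3 (rewrite (_ : (_ == _ :> int) = false) ?mul0r; last by apply/eqP; lia).
  by rewrite !addr0.
have [lt_ij|le_ji] := ltnP i j.
  by rewrite tridiag_mx_super; [apply: b_neq0 | ]; lia.
by rewrite tridiag_mx_sub; [apply: c_neq0 | ]; lia.
Qed.

Lemma mapA_tridiagonal : tridiagonal_action A (basis_proj dual_eigbasis).
Proof.
apply: (basis_proj_tridiagonal dual_eigbasis_basis) => i j ij; rewrite coord_mapA.
  by apply: (tridiag_mx_irreducible i j).1.
by apply: (tridiag_mx_irreducible i j).2.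
Qed.

Lemma mapAs_tridiagonal : tridiagonal_action As (basis_proj eigbasis).
Proof.
have coordE (i j : 'I_d.+1) : i != j ->
    (coord eigbasis i (As eigbasis`_j) == 0) = (`|i - j| > 1)%N.
  rewrite nth_eigbasis; case: (ltngtP i j) => [lt_ij _|lt_ij _|/val_inj ->].
  - by rewrite coord_mapAs_sym coord_mapAs_upper //; apply/idP/idP; lia.
  - by rewrite coord_mapAs_upper //; apply/idP/idP; lia.
  by rewrite eqxx.
apply: (basis_proj_tridiagonal eigbasis_basis) => i j ij.
  by apply/eqP; rewrite coordE //; apply: contraTneq ij => ->; lia.
by rewrite coordE ?ij //; apply: contra_eq_neq ij => ->; lia.
Qed.

Definition leonard_of_intersection_numbers : leonard_system d V :=
  LeonardSystem dim_column_space
    (eigenbasis_multiplicity_free eigbasis_basis theta_inj eigbasis_eigen)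
    (eigenbasis_multiplicity_free dual_eigbasis_basis thetas_inj dual_eigbasis_eigen)
    (eigenbasis_idempotent_ordering eigbasis_basis theta_inj eigbasis_eigen)
    (eigenbasis_idempotent_ordering dual_eigbasis_basis thetas_inj dual_eigbasis_eigen)
    mapA_tridiagonal mapAs_tridiagonal.

Local Notation Phi := leonard_of_intersection_numbers.

Lemma leonard_eigenvalue_sequence : eigenvalue_sequence Phi theta.
Proof.
move=> i v; rewrite /= (limg_basis_proj eigbasis_basis) => /vlineP [k ->].
by rewrite linearZ /= eigbasis_eigen !scalerA mulrC.
Qed.

Lemma leonard_dual_eigenvalue_sequence : dual_eigenvalue_sequence Phi thetas.
Proof.
move=> i v; rewrite /= (limg_basis_proj dual_eigbasis_basis) => /vlineP [k ->].
by rewrite linearZ /= dual_eigbasis_eigen !scalerA mulrC.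
Qed.

(** E_0 V is the line of the all-ones vector, so E*_i u is a common scalar s times the i-th unit
    vector; rescaling a whole basis by s leaves the matrix of A unchanged. *)
Lemma leonard_intersection_numbers : intersection_numbers Phi a b c.
Proof.
move=> u; rewrite /= (limg_basis_proj eigbasis_basis) => /vlineP [s def_u] u_neq0.
have s_neq0 : s != 0 by apply: contra_neq u_neq0 => s0; rewrite def_u s0 scale0r.
have Es_u (i : 'I_d.+1) : ls_Es Phi i u = s *: unit_vec i.
  rewrite /= basis_projE nth_dual_eigbasis coord_dual_eigbasis def_u extZ.
  by rewrite nth_eigbasis ext_ones ?mulr1 //; have := ltn_ord i; lia.
split; first by rewrite (eq_image (frefl _) Es_u) scaled_unit_vec_basis.
exists tridiag_mx; split.
- move=> j; rewrite Es_u linearZ /= -nth_dual_eigbasis.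
  rewrite {1}(coord_expand dual_eigbasis_basis (A _)) scaler_sumr.
  apply: eq_bigr => i _; rewrite coord_mapA Es_u nth_dual_eigbasis !scalerA.
  by rewrite mulrC.
- exact: tridiag_mx_irreducible.
- exact: tridiag_mx_diag.
- exact: tridiag_mx_super.
- exact: tridiag_mx_sub.
Qed.

End LeonardConstruction.

Theorem theorem4p1 (K : fieldType) (d : nat) (hd : (1 <= d)%N)
  (theta thetas a b c : int -> K)
  (h1 : forall i j : int, 0 <= i <= d -> 0 <= j <= d -> i != j ->
    theta i != theta j)
  (h2 : forall i : int, 1 <= i <= d -> thetas i != thetas 0)
  (beta gammas : K)
  (h3 : forall i : int, 1 <= i <= d%:Z - 1 ->
    gammas = thetas (i - 1) - beta * thetas i + thetas (i + 1))
  (h3_0 : gammas = thetas (-1) - beta * thetas 0 + thetas 1)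
  (h3_d : gammas = thetas (d%:Z - 1) - beta * thetas d + thetas (d%:Z + 1))
  (h4 : forall i : int, 1 <= i <= d -> b (i - 1) * c i != 0)
  (hbd : b d = 0) (hc0 : c 0 = 0)
  (h5 : forall i : int, 0 <= i <= d -> c i + a i + b i = theta 0)
  (as0 : K)
  (h6 : forall i : int, 0 <= i <= d ->
    c i * (thetas (i - 1) - thetas i) - b i * (thetas i - thetas (i + 1))
    = (theta 1 - theta 0) * (thetas i - as0))
  (theta_m1 : K)
  (h7 : forall i j : int, 1 <= i <= d -> 1 <= j <= d ->
    c i * (thetas (i - 1) - thetas (i + 1))
      - b (i - 1) * (thetas (i - 2) - thetas i)
      - (theta 0 - theta_m1) * (thetas (i - 1) + thetas i)
    = c j * (thetas (j - 1) - thetas (j + 1))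
      - b (j - 1) * (thetas (j - 2) - thetas j)
      - (theta 0 - theta_m1) * (thetas (j - 1) + thetas j))
  (gamma : K) (hgamma : gamma = theta_m1 - beta * theta 0 + theta 1)
  (h8 : forall i : int, 1 <= i <= d%:Z - 1 ->
    theta (i - 1) - beta * theta i + theta (i + 1) = gamma) :
  exists (V : vectType K) (Phi : leonard_system d V),
    [/\ eigenvalue_sequence Phi theta,
        dual_eigenvalue_sequence Phi thetas
      & intersection_numbers Phi a b c].
Proof.
have rec_thetas (i : int) : 0 <= i <= d ->
    gammas = thetas (i - 1) - beta * thetas i + thetas (i + 1).
  move=> i_d; have [->|i_neq0] := eqVneq i 0; first by rewrite !add0r.
  by have [->|i_neqd] := eqVneq i d; [exact: h3_d | apply: h3; lia].
exists 'cV[K]_d.+1.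
exists (leonard_of_intersection_numbers hd h1 h2 rec_thetas h4 hbd hc0 h5 h6 h7 hgamma h8).
split; [exact: leonard_eigenvalue_sequence | exact: leonard_dual_eigenvalue_sequence |].
exact: leonard_intersection_numbers.
Qed.
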